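(* Let $D$ be a $1$-extension of an oriented tree $F$ on $n$ vertices. Then $\mathrm{unv}(D)\le 8\,\mathrm{unv}^*(F)+3$.
   Context: A digraph is $p$-unavoidable if it is contained in (isomorphic to a subdigraph of) every tournament of order $p$; for an acyclic digraph $D$, $\mathrm{unv}(D)$ is the least such $p$. For an acyclic digraph $D$, $\mathrm{unv}^*(D)$ is the maximum of $\mathrm{unv}(H)+|V(D)\setminus V(H)|$ over all subdigraphs $H$ of $D$. An oriented tree is an orientation of a tree. For an acyclic digraph $A$ and positive integer $k$, an acyclic digraph $D$ is a $k$-extension of $A$ if there is a set $S$ of $k$ vertices of $D$ with $D-S=A$. *)

(* Defs.v *)
From mathcomp Require Import all_boot.
From mathcomp Require Import boolp.

Set Implicit Arguments.
Unset Strict Implicit.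
Unset Printing Implicit Defensive.

(** Digraphs are finite, without loops or parallel arcs; digons are allowed. *)
Record digraph := Digraph {
  vertex :> finType;
  arc : rel vertex;
  arc_irr : irreflexive arc }.

Definition isomorphic (D1 D2 : digraph) : Prop :=
  exists2 f : D1 -> D2, bijective f & forall x y, arc (f x) (f y) = arc x y.

(** A subdigraph is a pair (vertex set, arc set); it need not be induced or
    spanning, and may be empty. *)
Definition subdigraph_pred (D : digraph) : pred ({set D} * {set D * D}) :=
  fun H => [forall a in H.2, [&& arc a.1 a.2, a.1 \in H.1 & a.2 \in H.1]].

Definition subdigraph (D : digraph) := {H | @subdigraph_pred D H}.

Section Subdigraph.
Variables (D : digraph) (H : subdigraph D).

Definition vset : {set D} := (val H).1.
Definition aset : {set D * D} := (val H).2.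

Lemma asetP x y : (x, y) \in aset -> [/\ arc x y, x \in vset & y \in vset].
Proof. by move=> xy; have /forall_inP/(_ _ xy)/and3P := valP H. Qed.

Definition sub_arc : rel {x | x \in vset} := fun x y => (val x, val y) \in aset.

Lemma sub_arc_irr : irreflexive sub_arc.
Proof. by move=> x; apply/negP => /asetP[]; rewrite arc_irr. Qed.

Definition sub_digraph : digraph := Digraph sub_arc_irr.

End Subdigraph.

Section Deletion.
Variables (D : digraph) (S : {set D}).

Definition del_arc : rel {x | x \notin S} := fun x y => arc (val x) (val y).

Lemma del_arc_irr : irreflexive del_arc.
Proof. by move=> x; apply: arc_irr. Qed.

Definition del : digraph := Digraph del_arc_irr.

End Deletion.

Definition contains (T D : digraph) : Prop :=
  exists H : subdigraph T, isomorphic D (sub_digraph H).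

Definition tournament (T : digraph) : Prop :=
  forall x y : T, x != y -> arc x y (+) arc y x.

Definition unavoidable (p : nat) (D : digraph) : Prop :=
  forall T : digraph, tournament T -> #|T| = p -> contains T D.

Definition acyclic (D : digraph) : Prop :=
  forall c : seq D, c != [::] -> ~ ucycle (@arc D) c.

Record dag := Dag { dag_digraph :> digraph; dag_acyclic : acyclic dag_digraph }.

Lemma sub_acyclic (D : dag) (H : subdigraph D) : acyclic (sub_digraph H).
Proof.
move=> c c0 /andP[cc uc]; apply: (@dag_acyclic D (map val c)).
  by case: c c0 {cc uc}.
rewrite /ucycle map_inj_uniq ?uc ?andbT; last exact: val_inj.
rewrite cycle_map; by apply: sub_cycle cc => x y /asetP[].
Qed.

Definition sub_dag (D : dag) (H : subdigraph D) : dag := Dag (@sub_acyclic D H).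

Lemma containsP (T D : digraph) :
  contains T D <->
  exists2 f : D -> T, injective f & forall x y, arc x y -> arc (f x) (f y).
Proof.
split=> [[H [f /bij_inj fI fa]]|[f fI fa]].
  exists (val \o f) => [x y /val_inj/fI //|x y].
  by rewrite -fa => /asetP[].
pose H := ([set f x | x : D],
           [set (f a.1, f a.2) | a : D * D & arc a.1 a.2]).
have HP : subdigraph_pred H.
  apply/forall_inP => a /imsetP[[x y]]; rewrite inE /= => xy -> /=.
  by rewrite fa ?imset_f.
have fH x : f x \in vset (Sub H HP : subdigraph T) by exact: imset_f.
exists (Sub H HP), (fun x => Sub (f x) (fH x)).
  apply: inj_card_bij => [x y /(congr1 val)/= /fI //|].
  by rewrite card_sig /vset /= card_imset.
move=> x y; apply/imsetP/idP => /= [[[u v]]|xy].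
  by rewrite inE /= => uv [/fI -> /fI ->].
by exists (x, y); rewrite ?inE.
Qed.

Lemma acyclic_rank (D : dag) :
  exists r : D -> nat, forall x y, arc x y -> r y < r x.
Proof.
exists (fun x => #|[set z | connect (@arc D) x z]|) => x y xy.
apply: proper_card; apply/properP; split.
  apply/subsetP => z; rewrite !inE; apply: connect_trans; exact: connect1.
exists x; rewrite !inE ?connect0 //; apply/negP => /connectP[p yp xE].
move: xy; rewrite {}xE; case/shortenP: yp => q yq uq _ qy.
by apply: (@dag_acyclic D (y :: q)) => //; rewrite /ucycle uq /= rcons_path yq qy.
Qed.

Lemma tournament_chain (T : digraph) n (A : {set T}) :
  tournament T -> 2 ^ n <= #|A| ->
  exists s : seq T, [/\ size s = n, {subset s <= A} & pairwise (@arc T) s].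
Proof.
move=> tT; elim: n A => [|n IHn] A An; first by exists [::].
have /card_gt0P[x xA] : 0 < #|A| by apply: leq_trans An; rewrite expn_gt0.
pose O := [set y in A | arc x y]; pose I := [set y in A | arc y x].
have AE : A = x |: (O :|: I).
  apply/setP => y; rewrite !inE; have [->|nyx] := eqVneq y x; first by rewrite xA.
  by case: (y \in A) => //=; case: (arc x y) (arc y x) (tT y x nyx) => [] [].
have : (2 ^ n <= #|O|) || (2 ^ n <= #|I|).
  apply: contraLR An; rewrite negb_or -!ltnNge => /andP[On In].
  rewrite AE; apply: leq_ltn_trans (_ : (#|O| + #|I|).+1 < _).
    rewrite cardsU1 -add1n leq_add ?leq_b1 //; exact: leq_card_setU.
  by rewrite expnS mul2n -addnn; apply: leq_trans (leq_add On In); rewrite addSn addnS.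
case/orP => /IHn[s [sn sA sp]].
  exists (x :: s); split; first by rewrite /= sn.
    by move=> y; rewrite inE => /predU1P[->//|/sA]; rewrite inE => /andP[].
  by rewrite /= sp andbT; apply/allP => y /sA; rewrite inE => /andP[].
exists (rcons s x); split; first by rewrite size_rcons sn.
  move=> y; rewrite mem_rcons inE => /predU1P[->//|/sA].
  by rewrite inE => /andP[].
by rewrite pairwise_rcons sp andbT; apply/allP => y /sA; rewrite inE => /andP[].
Qed.

Lemma dag_unavoidable (D : dag) : exists p, `[< unavoidable p D >].
Proof.
exists (2 ^ #|D|); apply/asboolP => T tT Tn; apply/containsP.
have /card_gt0P[t0 _] : 0 < #|T| by rewrite Tn expn_gt0.
have [|s [sn _ sp]] := @tournament_chain T #|D| setT tT; first by rewrite cardsT Tn.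
have [r rP] := acyclic_rank D.
pose e : rel D := fun x y => r y <= r x.
have eT : transitive e by move=> y x z xy yz; apply: leq_trans yz xy.
pose s' := sort e (enum D).
have s'x x : x \in s' by rewrite mem_sort mem_enum.
have ix x : index x s' < size s by rewrite sn cardE -(size_sort e) index_mem.
have ss : sorted e s' by apply: sort_sorted => x y; apply: leq_total.
have fa x y : arc x y -> arc (nth t0 s (index x s')) (nth t0 s (index y s')).
  move=> xy; apply: (pairwiseP t0 sp); rewrite ?inE ?ix // ltnNge.
  apply/negP => yx; have := rP _ _ xy; rewrite ltnNge => /negP; apply.
  by apply: (@sorted_leq_index _ e eT _ s' ss y x) => // z; rewrite /e.
exists (fun x => nth t0 s (index x s')) => // x y /eqP.
rewrite nth_uniq ?ix // => [/eqP/index_inj|]; first exact.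
by apply: pairwise_uniq sp; apply: arc_irr.
Qed.

Definition unv (D : dag) : nat := ex_minn (dag_unavoidable D).

Definition unv_star (D : dag) : nat :=
  \max_(H : subdigraph D) (unv (sub_dag H) + #|~: vset H|).

Definition adj (D : digraph) : rel D := fun x y => arc x y || arc y x.

Definition is_tree (V : finType) (e : rel V) : Prop :=
  [/\ 0 < #|V|, forall x y, connect e x y
    & forall c : seq V, 2 < size c -> ~ ucycle e c].

(** The underlying graph is a tree; that no edge gets both orientations is part
    of acyclicity, and conversely any orientation of a tree is acyclic. *)
Definition oriented_tree (F : dag) : Prop := is_tree (@adj F).

(** The equality D - S = A is read up to isomorphism. *)
Definition extension (k : nat) (A D : dag) : Prop :=
  exists2 S : {set D}, #|S| = k & isomorphic (del S) A.

(* Main.v *)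
(** Let [u = unv_star F] and let [T] be a tournament of order [8 u + 3]. By
    convexity the average number of transitive triples [y -> x -> z], [y -> z]
    with middle [x] is at least [u (8 u + 2)], so for some [x] the bipartite
    digraph of arcs from the in- to the out-neighbourhood of [x] has average
    degree at least [2 u], hence a nonempty subgraph, with sides [L] and [R],
    of minimum degree at least [u].

    Let [s] be the extra vertex of [D], and colour a vertex of [F] according to
    whether its rank in a topological order is below that of [s]. Arcs of [F]
    between the colour classes go from the upper class to the lower one.
    Mapping [s] to [x], it suffices to embed [F] with the upper class in [L] and
    the lower one in [R]. This is done greedily, one monochromatic component
    [C] at a time: [C] is joined by a single edge to the part [U] already
    embedded, so it must avoid the image of [U] and lie in a neighbourhood of
    size at least [u >= unv C + #|F \ C|], which leaves [unv C] free vertices. *)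

From mathcomp Require Import all_boot boolp zify.
(* [Defs] comes last because [path] also has a constant [arc]. *)
Require Import Defs.

Set Implicit Arguments.
Unset Strict Implicit.
Unset Printing Implicit Defensive.

(** * Embedding into vertex subsets of a tournament *)

Lemma leq_unv (D : dag) p : unavoidable p D -> unv D <= p.
Proof.
move=> Dp; rewrite /unv; case: ex_minnP => m _; apply; exact/asboolP.
Qed.

(** Unavoidability concerns tournaments of order exactly [unv D], so [Z] is first cut down to that
    size. *)
Lemma unv_embed (D : dag) (T : digraph) (Z : {set T}) :
  tournament T -> unv D <= #|Z| ->
  exists f : D -> T, [/\ injective f, forall x y, arc x y -> arc (f x) (f y)
                       & forall x, f x \in Z].
Proof.
move=> tT /card_geqP[s [us ss sZ]].
pose T' := del (~: [set:: s]).
have tT' : tournament T' by move=> x y xy; apply: tT.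
have cT' : #|T'| = unv D.
  by rewrite card_sig -ss -(card_uniqP us); apply: eq_card => x; rewrite !inE negbK.
have : unavoidable (unv D) D.
  by apply/asboolP; rewrite /unv; case: ex_minnP.
move=> /(_ T' tT' cT')/containsP[f fI fa].
exists (val \o f); split => [|x y /fa //|x]; first exact: inj_comp val_inj fI.
by apply: sZ; have := valP (f x); rewrite !inE negbK.
Qed.

Lemma unv_star_ge (D : dag) (H : subdigraph D) :
  unv (sub_dag H) + #|~: vset H| <= unv_star D.
Proof. exact: (leq_bigmax H). Qed.

(** * Counting transitive triples and extracting the dense pair *)

Lemma card_arcs_tournament (T : digraph) (A : {set T}) : tournament T ->
  #|A| * #|A| = #|A| + 2 * \sum_(x in A) \sum_(y in A) arc x y.
Proof.
move=> tT; have -> : #|A| * #|A| =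
    \sum_(x in A) \sum_(y in A) ((x == y) + arc x y + arc y x).
  rewrite -sum_nat_const; apply: eq_bigr => x _; rewrite -sum1_card.
  apply: eq_bigr => y _; have [<-|/tT] := eqVneq x y; first by rewrite arc_irr.
  by case: (arc x y) (arc y x) => [] [].
under eq_bigr => x xA do rewrite 2!big_split /=.
rewrite 2!big_split /= [X in _ + _ + X]exchange_big /=.
have -> : \sum_(x in A) \sum_(y in A) (x == y) = #|A|.
  rewrite -sum1_card; apply: eq_bigr => x xA.
  by rewrite (bigD1 x) //= eqxx big1 // => y /andP[_ /negPf]; rewrite eq_sym => ->.
by rewrite mul2n -addnn addnA.
Qed.

Lemma sum_indicator (T : finType) (P : pred T) (G : T -> nat) :
  \sum_(x in [set x | P x]) G x = \sum_x P x * G x.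
Proof.
by rewrite big_mkcond; apply: eq_bigr => x _; rewrite inE; case: (P x); rewrite ?mul1n.
Qed.

(** Triples are counted by their source [y]: they are the arcs inside its out-neighbourhood, half of
    [d * (d - 1)] for out-degree [d]. The average out-degree is [4u + 1], so by convexity the
    average count is at least [(4u + 1) * 4u / 2 = u * (8u + 2)]. *)
Lemma exists_middle_vertex (T : digraph) u : tournament T -> #|T| = 8 * u + 3 ->
  exists x : T, u * (8 * u + 2) <=
    \sum_y \sum_z [&& arc y x, arc x z & arc y z].
Proof.
move=> tT cT; apply/existsP; apply/contraT; rewrite negb_exists => /forallP small.
pose d y := #|[set x | @arc T y x]|.
pose t y := \sum_(x in [set x | @arc T y x]) \sum_(z in [set x | arc y x]) @arc T x z.
have dt y : d y * d y = d y + 2 * t y by apply: card_arcs_tournament.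
have sd : \sum_y d y = #|T| * (4 * u + 1).
  have := card_arcs_tournament setT tT; rewrite cardsT.
  have -> : \sum_(x in [set: T]) \sum_(y in [set: T]) arc x y = \sum_y d y.
    under eq_bigl do rewrite in_setT; apply: eq_bigr => x _.
    under eq_bigl do rewrite in_setT; rewrite /d -sum1_card [RHS]big_mkcond.
    by apply: eq_bigr => y _; rewrite inE; case: arc.
  rewrite cT; nia.
have st : \sum_x \sum_y \sum_z [&& arc y x, @arc T x z & arc y z] = \sum_y t y.
  rewrite exchange_big; apply: eq_bigr => y _.
  rewrite /t sum_indicator; apply: eq_bigr => x _.
  rewrite sum_indicator big_distrr; apply: eq_bigr => z _ /=.
  by case: (arc y x) (arc x z) (arc y z) => [] [] [].
have lt : \sum_y t y + #|T| <= #|T| * (u * (8 * u + 2)).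
  rewrite -st -[X in _ + X]sum1_card -sum_nat_const -big_split /=.
  by apply: leq_sum => x _; rewrite addn1 ltnNge small.
(* Convexity in tangent form: [2 * a * d <= d * d + a * a] at the mean [a = 4u + 1], with
   [d * d = d + 2 * t]. *)
have : \sum_y (2 * (4 * u + 1) * d y) <=
       \sum_y (d y + 2 * t y + (4 * u + 1) * (4 * u + 1)).
  apply: leq_sum => y _; rewrite -dt -mulnA [leqRHS]addnC.
  by rewrite !mulnn (nat_Cauchy (4 * u + 1) (d y)).
rewrite 2!big_split /= sum_nat_const -[leqLHS]big_distrr.
rewrite -[X in _ + X + _]big_distrr /= sd.
have : 0 < #|T| by rewrite cT; lia.
move: lt; set N := #|T|; set t' := \sum_y t y.
(* The inequality is linear once all products are reduced to [N * (u * p)] and [N * p]. *)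
set p := 4 * u + 1; rewrite (_ : u * (8 * u + 2) = 2 * u * p); last by rewrite /p; lia.
have -> : 2 * p * (N * p) = 2 * (N * (p * p)) by lia.
have -> : N * (2 * u * p) = 2 * (N * (u * p)) by lia.
have -> : N * (p * p) = 4 * (N * (u * p)) + N * p by rewrite {1}/p; lia.
clear; lia.
Qed.

(** Deleting a vertex of total degree below [u] keeps at least [u] arcs per vertex. A single vertex
    carries no arc, so the deletion stops before the set is exhausted. *)
Lemma exists_min_degree (T : finType) (b : rel T) u (W0 : {set T}) :
    irreflexive b -> 0 < u -> W0 != set0 ->
    u * #|W0| <= \sum_(y in W0) \sum_(z in W0) b y z ->
  exists2 W : {set T}, W \subset W0 /\ W != set0 &
    forall w, w \in W -> u <= \sum_(z in W) (b w z + b z w).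
Proof.
move=> bI u0; have [m] := ubnP #|W0|; elim: m W0 => // m IH W0 cW W0n eW.
have [/forall_inP deg|] := boolP
  [forall w in W0, u <= \sum_(z in W0) (b w z + b z w)].
  by exists W0.
rewrite negb_forall_in => /exists_inP[w wW]; rewrite -ltnNge => degw.
have splitW : \sum_(y in W0) \sum_(z in W0) b y z =
    \sum_(y in W0 :\ w) \sum_(z in W0 :\ w) b y z +
    \sum_(z in W0) (b w z + b z w).
  rewrite (big_setD1 w) //= [X in _ = _ + X]big_split /=.
  under [X in _ + X = _]eq_bigr => y yW do rewrite (big_setD1 w) //=.
  rewrite big_split /= [X in _ = _ + (_ + X)](big_setD1 w) //= bI; lia.
have cD := cardsD1 w W0; rewrite wW /= in cD.
have [D0|Dn] := eqVneq (W0 :\ w) set0.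
  by move: eW; rewrite splitW cD D0 big_set0 cards0; lia.
have [|||W [WD Wn] degW] := IH (W0 :\ w) => //; try nia.
by exists W => //; split => //; apply: subset_trans WD (subsetDl _ _).
Qed.

Lemma exists_dense_pair (T : digraph) u :
    tournament T -> 0 < u -> #|T| = 8 * u + 3 ->
  exists x : T, exists L R : {set T},
    [/\ [/\ forall y, y \in L -> arc y x & forall z, z \in R -> arc x z],
      u <= #|L|, u <= #|R|,
      forall y, y \in L -> u <= #|[set z in R | arc y z]| &
      forall z, z \in R -> u <= #|[set y in L | arc y z]|].
Proof.
move=> tT u0 cT; have [x xP] := exists_middle_vertex tT cT.
pose b : rel T := fun y z => [&& arc y x, arc x z & arc y z].
have asym y z : @arc T y z -> arc z y = false.
  move=> yz; have : y != z by apply: contraTneq yz => ->; rewrite arc_irr.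
  by move/tT; rewrite yz; case: arc.
have bI : irreflexive b by move=> y; rewrite /b arc_irr !andbF.
have cx : #|~: [set x]| = 8 * u + 2 by have := cardsC1 x; rewrite cT; lia.
(* [T] without [x] has [8u + 2] vertices, so the triple bound amounts to [u] arcs of [b] per
   vertex. *)
have [|| W [Wx Wn] degW] := @exists_min_degree _ b u (~: [set x]) bI u0.
- by rewrite -card_gt0 cx; lia.
- rewrite cx; apply: leq_trans xP _; rewrite leq_eqVlt; apply/orP; left; apply/eqP.
  rewrite [RHS]big_mkcond; apply: eq_bigr => y _; rewrite !inE.
  have [->|ynx] /= := eqVneq y x; first by rewrite big1 // => z _; rewrite arc_irr.
  rewrite [RHS]big_mkcond; apply: eq_bigr => z _; rewrite !inE.
  by have [->|] := eqVneq z x; rewrite ?arc_irr ?andbF.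
pose L := [set y in W | arc y x]; pose R := [set z in W | arc x z].
(* All [b]-arcs at a vertex of [L] leave it and all those at a vertex of [R] enter it, so total
   degrees are one-sided. *)
have degL y : y \in L -> u <= #|[set z in R | arc y z]|.
  rewrite inE => /andP[yW yx]; apply: leq_trans (degW _ yW) _.
  rewrite -sum1_card [leqLHS]big_mkcond [leqRHS]big_mkcond.
  apply: leq_sum => z _; rewrite !inE /b yx (asym _ _ yx) /= andbF addn0.
  by case: (z \in W); case: (arc x z); case: arc.
have degR z : z \in R -> u <= #|[set y in L | arc y z]|.
  rewrite inE => /andP[zW xz]; apply: leq_trans (degW _ zW) _.
  rewrite -sum1_card [leqLHS]big_mkcond [leqRHS]big_mkcond.
  apply: leq_sum => y _; rewrite !inE /b xz (asym _ _ xz) /= add0n.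
  by case: (y \in W); case: (arc y x); case: arc.
have leL z : #|[set y in L | arc y z]| <= #|L|.
  by apply/subset_leq_card/subsetP => y; rewrite inE => /andP[].
have leR y : #|[set z in R | arc y z]| <= #|R|.
  by apply/subset_leq_card/subsetP => z; rewrite inE => /andP[].
(* [W] meets one side; a positive degree yields a neighbour on the other, and each degree bounds the
   opposite side from below. *)
have [uL uR] : u <= #|L| /\ u <= #|R|.
  case/set0Pn: Wn => w wW; have : w != x by move/subsetP: Wx => /(_ _ wW); rewrite !inE.
  move/tT => wx; have [wL|wR] : w \in L \/ w \in R.
  - by rewrite !inE wW; case: (arc w x) wx => /=; [left|right].
  - have uR := leq_trans (degL _ wL) (leR _); split => //.
    have /card_gt0P[z zR] := leq_trans u0 uR.
    exact: leq_trans (degR _ zR) (leL _).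
  - have uL := leq_trans (degR _ wR) (leL _); split => //.
    have /card_gt0P[y yL] := leq_trans u0 uL.
    exact: leq_trans (degL _ yL) (leR _).
exists x, L, R; split => //; split => y; by rewrite inE => /andP[].
Qed.

(** * Connected parts of a tree and the edges between them *)

Definition induced (V : finType) (e : rel V) (U : {set V}) : rel V :=
  fun x y => [&& e x y, x \in U & y \in U].

Lemma induced_path (V : finType) (e : rel V) (U : {set V}) x y :
  x \in U -> connect (induced e U) x y ->
  exists p, [/\ path e x p, last x p = y, uniq (x :: p) & {subset x :: p <= U}].
Proof.
move=> xU /connectP[p0 /shortenP[p xp up _] ->]; exists p; split => //.
  by apply: sub_path xp => a b /and3P[].
move=> z; rewrite inE => /predU1P[->//|].
elim: p x xU xp {up} => //= a p IH x _ /andP[/and3P[_ _ aU] ap].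
by rewrite inE => /predU1P[->//|]; apply: IH aU ap.
Qed.

(** Two such edges, with a path inside each part joining their ends, close up to a cycle. *)
Lemma acyclic_edge_unique (V : finType) (e : rel V) (U C : {set V}) u v u' v' :
    (forall c : seq V, 2 < size c -> ~ ucycle e c) -> symmetric e ->
    [disjoint U & C] ->
    {in U &, forall x y, connect (induced e U) x y} ->
    {in C &, forall x y, connect (induced e C) x y} ->
    u \in U -> v \in C -> u' \in U -> v' \in C -> e u v -> e u' v' ->
  u = u' /\ v = v'.
Proof.
move=> acyc esym UC cU cC uU vC uU' vC' uv uv'.
have [p [pp pl pu ps]] := induced_path uU (cU _ _ uU uU').
have [q [qp ql qu qs]] := induced_path vC' (cC _ _ vC' vC).
have uc : ucycle e ((u :: p) ++ (v' :: q)).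
  rewrite /ucycle cat_uniq pu qu andbT; apply/andP; split.
    by rewrite /= rcons_cat cat_path pp pl /= uv' rcons_path qp ql esym uv.
  apply/hasPn => z /qs zC; apply/negP => /ps zU.
  by move/pred0P: UC => /(_ z) /=; rewrite zU zC.
(* If both paths are trivial the edges coincide; otherwise the cycle has at least three vertices. *)
case: p q pl ql uc {pp pu ps qp qu qs} => [|a p] [|a' q] pl ql uc //.
all: by case: (acyc _ _ uc); rewrite ?size_cat //= !addnS.
Qed.

(** [unv_star F] covers [unv] of the subdigraph induced on [C] plus the number of vertices outside
    [C], and [f @: U] uses up at most the latter. *)
Lemma embed_avoiding (F : dag) (T : digraph) (C : {set F}) (U : {set F})
    (f : F -> T) (Z : {set T}) :
    tournament T -> [disjoint U & C] -> unv_star F <= #|Z| ->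
  exists g : F -> T, [/\ {in U, g =1 f}, {in C, forall x, g x \in Z :\: f @: U},
    {in C &, injective g} & {in C &, forall x y, arc x y -> arc (g x) (g y)}].
Proof.
move=> tT UC uZ.
pose H := (C, [set a : F * F | [&& arc a.1 a.2, a.1 \in C & a.2 \in C]]).
have HP : subdigraph_pred H by apply/forall_inP => a; rewrite inE.
pose SH : subdigraph F := Sub H HP.
have le : unv (sub_dag SH) <= #|Z :\: f @: U|.
  have h1 : unv (sub_dag SH) + #|~: C| <= unv_star F := unv_star_ge SH.
  have h2 : #|U| <= #|~: C| by rewrite subset_leq_card // -disjoints_subset.
  have h3 : #|Z :&: f @: U| <= #|U|.
    exact: leq_trans (subset_leq_card (subsetIr _ _)) (leq_imset_card _ _).
  rewrite cardsD; lia.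
have [k [kI ka kZ]] := unv_embed tT le.
pose g x := if insub x : {? x | x \in vset SH} is Some y then k y else f x.
have gC x (xC : x \in C) : g x = k (Sub x xC).
  by rewrite /g; case: insubP => [y _ yE|]; [congr k; apply: val_inj | rewrite xC].
exists g; split => [x xU|x xC|x y xC yC|x y xC yC xy].
- rewrite /g insubN //; apply/negP => xC.
  by move/pred0P: UC => /(_ x) /=; rewrite xU xC.
- by rewrite gC kZ.
- by rewrite !gC => /kI /(congr1 val).
- by rewrite !gC; apply: ka; rewrite /= /sub_arc inE /= xy xC yC.
Qed.

Lemma adj_sym (D : digraph) : symmetric (@adj D).
Proof. by move=> x y; rewrite /adj orbC. Qed.

(** The empty subdigraph competes in the maximum. *)
Lemma card_le_unv_star (D : dag) : #|D| <= unv_star D.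
Proof.
have HP : @subdigraph_pred D (set0, set0) by apply/forall_inP => a; rewrite inE.
apply: leq_trans (unv_star_ge (Sub _ HP)).
by apply: leq_trans (leq_addl _ _); rewrite /vset /= setC0 cardsT.
Qed.

(** * Greedy embedding of a two-coloured oriented tree *)

Section ColoredTree.
Variables (F : dag) (T : digraph) (c : F -> bool) (L R : {set T}).
Hypotheses (tT : tournament T) (tF : oriented_tree F).
(** [c] is true on the lower class, which is sent to [R]. *)
Hypothesis cP : forall x y : F, arc x y -> c x -> c y.
Hypotheses (uL : unv_star F <= #|L|) (uR : unv_star F <= #|R|).
Hypothesis degL : forall y, y \in L -> unv_star F <= #|[set z in R | arc y z]|.
Hypothesis degR : forall z, z \in R -> unv_star F <= #|[set y in L | arc y z]|.

Let side x := if c x then R else L.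
Let mono : rel F := fun x y => adj x y && (c x == c y).
Let comp v : {set F} := [set y | connect mono v y].

Let monoC : connect_sym mono.
Proof. by apply: sym_connect_sym => x y; rewrite /mono adj_sym eq_sym. Qed.

Let comp_closed v : closed mono (comp v).
Proof. by move=> x y xy; rewrite !inE; apply: same_connect_r (connect1 xy) _. Qed.

Let comp_color v y : y \in comp v -> c y = c v.
Proof.
have cc : closed mono [pred x | c x == c v].
  by move=> x z /andP[_ /eqP]; rewrite !inE => ->.
by rewrite inE => /(closed_connect cc); rewrite !inE eqxx => /esym/eqP.
Qed.

Let comp_connected v : {in comp v &, forall x y, connect (induced (@adj F) (comp v)) x y}.
Proof.
move=> x y xC; rewrite inE => vy; move: (xC); rewrite inE monoC => xv.
have /connectP[p xp ->] := connect_trans xv vy.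
elim: p x xC xp {xv} => [|a p IH] x xC /=; first by rewrite connect0.
case/andP=> xa ap; have aC : a \in comp v by rewrite -(comp_closed v xa).
apply: connect_trans (IH _ aC ap); apply: connect1.
by rewrite /induced xC aC; case/andP: xa => ->.
Qed.

Let good (U : {set F}) (f : F -> T) :=
  [/\ {in U &, injective f}, {in U &, forall x y, arc x y -> arc (f x) (f y)}
    & {in U, forall x, f x \in side x}].

(** If no edge leaves [U], it is closed under adjacency, hence empty or everything as [F] is
    connected. *)
Let attach_vertex (U : {set F}) : U != setT ->
  exists2 v, v \notin U & U = set0 \/ exists2 u, u \in U & adj u v.
Proof.
move=> UT; have [w wU] : exists w, w \notin U.
  apply/existsP; apply: contraR UT; rewrite negb_exists => /forallP h.
  by apply/eqP/setP => x; rewrite inE; apply/negPn.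
have [->|/set0Pn[u0 u0U]] := eqVneq U set0; first by exists w; rewrite ?inE //; left.
have [/exists_inP[v vU /exists_inP[u uU uv]]|] :=
  boolP [exists v in ~: U, exists u in U, adj u v].
  by exists v; [rewrite inE in vU | right; exists u].
rewrite negb_exists_in => /forall_inP nouv.
have [_ conF _] := tF.
have cl : closed (@adj F) U.
  apply: intro_closed; first exact/sym_connect_sym/adj_sym.
  move=> x y xy xU; apply/negPn/negP => yU.
  have /nouv : y \in ~: U by rewrite inE.
  by rewrite negb_exists_in => /forall_inP/(_ x xU); rewrite xy.
by move: wU; rewrite -(closed_connect cl (conF u0 w)) u0U.
Qed.

(** Closure under [mono] makes [U] a union of components, hence disjoint from the next one;
    connectedness of [U] makes the edge to that component unique. *)
Let extend (U : {set F}) (f : F -> T) :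
    closed mono U -> {in U &, forall x y, connect (induced (@adj F) U) x y} ->
    good U f -> U != setT ->
  exists (U' : {set F}) g, [/\ U \proper U', closed mono U',
    {in U' &, forall x y, connect (induced (@adj F) U') x y} & good U' g].
Proof.
move=> clU cU [fI fa fs] /attach_vertex[v vU Uv].
have vC : v \in comp v by rewrite inE connect0.
have UC : [disjoint U & comp v].
  apply/pred0P => x /=; apply/negP => /andP[xU]; rewrite inE.
  by move=> /(closed_connect clU); rewrite xU (negPf vU).
have [_ _ acyc] := tF.
(* As far as arcs to [U] are concerned, any vertex of [Z] may be the image of any vertex of
   [comp v]: [Z] is a whole side if [U] is empty, and otherwise a neighbourhood of [f u]. *)
have [Z [uZ Zs Zarc]] : exists Z : {set T}, [/\ unv_star F <= #|Z|,
    {subset Z <= side v} & forall x y z, x \in U -> y \in comp v -> z \in Z ->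
      (arc x y -> arc (f x) z) /\ (arc y x -> arc z (f x))].
  case: Uv => [->|[u uU uv]].
    by exists (side v); split; [rewrite /side; case: ifP | | move=> x ? ?; rewrite inE].
  have uniq_edge x y : x \in U -> y \in comp v -> adj x y -> u = x /\ v = y.
    move=> xU yC xy.
    exact: (acyclic_edge_unique acyc (@adj_sym F) UC cU (@comp_connected v)).
  have nuv : c u != c v.
    apply/negP => cuv; have /clU : mono u v by rewrite /mono uv.
    by rewrite uU (negPf vU).
  have noarc x y : @arc F x y -> c x = true -> c y = false -> false.
    by move=> xy cx; rewrite (cP xy cx).
  have := fs u uU; rewrite /side.
  case cv : (c v) nuv; case cu : (c u) => // _ fu.
  (* Here [u] is upper and [v] lower: an arc from [comp v] back to [U] would go from [v] to [u],
     against [cP]. *)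
  - exists [set z in R | arc (f u) z]; split; [exact: degL | | ].
      by move=> z; rewrite inE => /andP[].
    move=> x y z xU yC; rewrite inE => /andP[_ uz]; split=> xy.
      by have [|<- _] := uniq_edge x y xU yC; rewrite /adj ?xy.
    have [|ux vy] := uniq_edge x y xU yC; first by rewrite /adj xy orbT.
    by have := noarc y x xy; rewrite -ux -vy cv cu => /(_ erefl erefl).
  - exists [set y in L | arc y (f u)]; split; [exact: degR | | ].
      by move=> z; rewrite inE => /andP[].
    move=> x y z xU yC; rewrite inE => /andP[_ uz]; split=> xy; last first.
      by have [|<- _] := uniq_edge x y xU yC; rewrite /adj ?xy ?orbT.
    have [|ux vy] := uniq_edge x y xU yC; first by rewrite /adj xy.
    by have := noarc x y xy; rewrite -ux -vy cv cu => /(_ erefl erefl).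
have [g [gU gC gI ga]] := embed_avoiding f tT UC uZ.
have gZ x : x \in comp v -> g x \in Z by move=> /gC; rewrite inE => /andP[].
have gN x y : x \in U -> y \in comp v -> g x != g y.
  move=> xU /gC; rewrite inE (gU x xU) => /andP[+ _]; apply: contraNneq => <-.
  exact: imset_f.
exists (U :|: comp v), g; split.
- apply/properP; split; first exact: subsetUl.
  by exists v => //; rewrite inE vC orbT.
- by move=> x y xy; rewrite !in_setU (clU _ _ xy) (comp_closed v xy).
- have wid (A : {set F}) x y : A \subset U :|: comp v ->
    connect (induced (@adj F) A) x y ->
    connect (induced (@adj F) (U :|: comp v)) x y.
    move=> /subsetP sA; apply: connect_sub => a b /and3P[ab aA bA].
    by apply: connect1; rewrite /induced ab !sA.
  have wU := wid _ _ _ (subsetUl U (comp v)); have wC := wid _ _ _ (subsetUr U (comp v)).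
  have iC : connect_sym (induced (@adj F) (U :|: comp v)).
    by apply: sym_connect_sym => x y; rewrite /induced adj_sym [X in _ && X]andbC.
  have UCc x y : x \in U -> y \in comp v ->
      connect (induced (@adj F) (U :|: comp v)) x y.
    case: Uv => [->|[u uU uv]] xU yC; first by rewrite inE in xU.
    apply: connect_trans (wU _ _ (cU _ _ xU uU)) _.
    apply: connect_trans (wC _ _ (comp_connected vC yC)).
    by apply: connect1; rewrite /induced uv !in_setU uU vC orbT.
  move=> x y /setUP[xU|xC] /setUP[yU|yC]; first exact/wU/cU.
  + exact: UCc.
  + by rewrite iC; apply: UCc.
  + exact/wC/comp_connected.
- split.
  + move=> x y /setUP[xU|xC] /setUP[yU|yC].
    * by rewrite !gU //; apply: fI.
    * by move/eqP; rewrite (negPf (gN _ _ xU yC)).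
    * by move/eqP; rewrite eq_sym (negPf (gN _ _ yU xC)).
    * exact: gI.
  + move=> x y /setUP[xU|xC] /setUP[yU|yC] xy.
    * by rewrite !gU //; apply: fa.
    * by have [/(_ xy) + _] := Zarc x y (g y) xU yC (gZ _ yC); rewrite (gU x).
    * by have [_ /(_ xy)] := Zarc y x (g x) yU xC (gZ _ xC); rewrite (gU y).
    * exact: ga.
  + move=> x /setUP[xU|xC]; first by rewrite gU ?fs.
    by have := Zs _ (gZ _ xC); rewrite /side (comp_color xC).
Qed.

Lemma embed_colored_tree : exists f : F -> T,
  [/\ injective f, forall x y, arc x y -> arc (f x) (f y)
    & forall x, f x \in if c x then R else L].
Proof.
have [F0 _ _] := tF.
(* [t0] is a filler value for the map that starts the induction at the empty set. *)
have /card_gt0P[t0 _] : 0 < #|L|.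
  exact: leq_trans F0 (leq_trans (card_le_unv_star F) uL).
have final (U : {set F}) f : closed mono U ->
    {in U &, forall x y, connect (induced (@adj F) U) x y} -> good U f ->
    exists g, good setT g.
  have [m] := ubnP #|~: U|; elim: m U f => // m IH U f Um clU cU gU.
  have [UT|UT] := eqVneq U setT; first by exists f; rewrite -UT.
  have [U' [g [UU' clU' cU' gU']]] := extend clU cU gU UT.
  apply: IH clU' cU' gU'; apply: leq_trans (Um : #|~: U| <= m).
  by apply: proper_card; rewrite properC.
have [||| f [fI fa fs]] := final set0 (fun=> t0).
- by move=> x y _; rewrite !inE.
- by move=> x y; rewrite inE.
- by split=> x; rewrite ?inE // => y; rewrite inE.
by exists f; split=> [x y|x y|x]; [apply: fI | apply: fa | apply: fs]; rewrite inE.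
Qed.

End ColoredTree.

(** * Adding the extra vertex *)

Theorem theorem21 (n : nat) (F D : dag) (hF : oriented_tree F)
    (hn : #|F| = n) (hD : extension 1 F D) :
  unv D <= 8 * unv_star F + 3.
Proof.
case: hD => S /eqP/cards1P[s SE] [k [h kh hk] ka].
have inS d : (d \in S) = (d == s) by rewrite SE inE.
have hS y : val (h y) != s by rewrite -inS; apply: valP (h y).
have ha x y : arc x y = arc (val (h x)) (val (h y)) by rewrite -{1}(hk x) -{1}(hk y) ka.
have hI : injective (fun y => val (h y)).
  by move=> x y /val_inj/(can_inj hk).
have hsurj d : d != s -> exists y, val (h y) = d.
  move=> ds; have dS : d \notin S by rewrite inS.
  by exists (k (Sub d dS)); rewrite kh.
have [r rP] := acyclic_rank D.
(* Arcs lower the rank, so out-neighbours of [s] go to [R] and in-neighbours to [L]; a vertex tied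
   with [s] is not adjacent to it. *)
pose c y := r (val (h y)) < r s.
apply: leq_unv => T tT cT; apply/containsP.
have u0 : 0 < unv_star F by case: hF => F0 _ _; exact: leq_trans F0 (card_le_unv_star F).
have [x0 [L [R [[Lx xR] uL uR degL degR]]]] := exists_dense_pair tT u0 cT.
have cP x y : arc x y -> c x -> c y by rewrite ha => /rP; apply: ltn_trans.
have [f [fI fa fs]] := embed_colored_tree tT hF cP uL uR degL degR.
have fx y : f y != x0.
  apply/eqP => fy; have := fs y; rewrite fy.
  by case: (c y) => [/xR|/Lx]; rewrite arc_irr.
(* [pick] inverts [h] away from [s]; the default [x0] is the image of [s]. *)
pose phi d := if [pick y | val (h y) == d] is Some y then f y else x0.
have phih y : phi (val (h y)) = f y.
  rewrite /phi; case: pickP => [z /eqP/hI -> //|/(_ y)]; by rewrite eqxx.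
have phis : phi s = x0.
  by rewrite /phi; case: pickP => // y; rewrite (negPf (hS y)).
have dP d : d = s \/ exists y, d = val (h y).
  by have [->|/hsurj[y <-]] := eqVneq d s; [left | right; exists y].
exists phi.
  move=> d e; case: (dP d) => [->|[y ->]]; case: (dP e) => [->|[z ->]] //.
  - by rewrite phis phih => /esym/eqP; rewrite (negPf (fx _)).
  - by rewrite phis phih => /eqP; rewrite (negPf (fx _)).
  - by rewrite !phih => /fI ->.
move=> d e; case: (dP d) => [->|[y ->]]; case: (dP e) => [->|[z ->]].
- by rewrite arc_irr.
- by move=> /rP sz; rewrite phis phih; have := fs z; rewrite /c sz => /xR.
- by move=> /rP ys; rewrite phis phih; have := fs y; rewrite /c ltnNge (ltnW ys) => /Lx.
- by rewrite -ha !phih => /fa.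
Qed.
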